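(* Let $\mathbf{x}=(x_1,\dots,x_n)$ be an $n$-periodic trajectory of the discrete Lagrangian system with Lagrangian $L$ on $M\times M$, and let $P$ be its linear Poincaré map. Then for any $\rho\in\mathbb{C}$, $\rho\neq0$, $$\det(P-\rho I)=\frac{\det \mathbf{H}_\rho}{\det \mathbf{B}_\rho}.$$
   Context: $M$ is an $m$-dimensional manifold and $L$ a smooth function on $M\times M$; $\partial_1L,\partial_2L$ denote differentials of $L(x,y)$ in $x$ and $y$. $B(x,y)=-\partial_1\partial_2L(x,y):T_xM\to T_y^*M$ is assumed nondegenerate (twist condition; it suffices near the trajectory). The discrete Lagrangian system is the locally defined map $T(x,y)=(y,z)$, $\partial_2L(x,y)+\partial_1L(y,z)=0$. An $n$-periodic trajectory is $(x_i)_{i\in\mathbb{Z}}$, $x_{i+n}=x_i$, with $\partial_2L(x_{i-1},x_i)+\partial_1L(x_i,x_{i+1})=0$ for all $i$. The linear Poincaré map is $P=D(T^n)(x_1,x_2)$ acting on $T_{(x_1,x_2)}M^2$. Let $E_i=T_{x_i}M$ (complexified when needed, also denoted $E_i$), $X=E_1\times\dots\times E_n$, $B_i=B(x_i,x_{i+1}):E_i\to E_{i+1}^*$, and let $A_i=\partial_{22}L(x_{i-1},x_i)+\partial_{11}L(x_i,x_{i+1}):E_i\to E_i^*$ (symmetric); $A_i,B_i$ are $n$-periodic in $i$. For $\rho\ne0$ the operators $\mathbf{H}_\rho,\mathbf{B}_\rho:X\to X^*$ are defined, for $\mathbf{u}=(u_1,\dots,u_n)$, by $$(\mathbf{H}_\rho\mathbf{u})_j=A_ju_j-B_{j-1}u_{j-1}-B_j^*u_{j+1},\qquad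 (\mathbf{B}_\rho\mathbf{u})_j=-B_{j-1}u_{j-1},\qquad j=1,\dots,n,$$ with the convention $u_0=\rho^{-1}u_n$, $u_{n+1}=\rho u_1$. The quotient $\det\mathbf{H}_\rho/\det\mathbf{B}_\rho=\det(\mathbf{B}_\rho^{-1}\mathbf{H}_\rho)$ does not depend on the choice of bases. *)

(* Defs.v *)
From HB Require Import structures.
From mathcomp Require Import all_boot all_order all_algebra.
From mathcomp Require Import all_classical all_reals all_analysis.
From mathcomp Require Import complex.
Set Implicit Arguments.
Unset Strict Implicit.
Unset Printing Implicit Defensive.

Import Order.TTheory GRing.Theory Num.Theory.
Import numFieldNormedType.Exports.

Local Open Scope classical_set_scope.
Local Open Scope ring_scope.

Section Smooth.
Variables (R : realType) (k : nat) (W : normedModType R).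

Fixpoint Cr_on (r : nat) (O : set 'rV[R]_k) (f : 'rV[R]_k -> W) : Prop :=
  if r is r'.+1 then
    (forall v, O v -> differentiable f v) /\
    (forall h : 'rV[R]_k, Cr_on r' O ('D_h f))
  else forall v, O v -> {for v, continuous f}.

Definition smooth_on (O : set 'rV[R]_k) (f : 'rV[R]_k -> W) : Prop :=
  forall r, Cr_on r O f.

End Smooth.

Section Derivatives.
Variables (R : realType) (k : nat).

Definition basis_vec (a : 'I_k) : 'rV[R]_k := delta_mx 0 a.

Definition grad (f : 'rV[R]_k -> R) (p : 'rV[R]_k) : 'rV[R]_k :=
  \row_a 'D_(basis_vec a) f p.

Definition hessian (f : 'rV[R]_k -> R) (p : 'rV[R]_k) : 'M[R]_k :=
  \matrix_(a, b) 'D_(basis_vec a) ('D_(basis_vec b) f) p.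

End Derivatives.

(* [chart_inv] is only meaningful on [chart_im]. *)
Record chart (R : realType) (m : nat) (M : topologicalType) := Chart {
  chart_dom : set M;
  chart_im  : set 'rV[R]_m;
  chart_map :> M -> 'rV[R]_m;
  chart_inv : 'rV[R]_m -> M;
  chart_dom_open : open chart_dom;
  chart_im_open  : open chart_im;
  chart_mapP : forall p, chart_dom p -> chart_im (chart_map p);
  chart_invP : forall v, chart_im v -> chart_dom (chart_inv v);
  chart_mapK : forall p, chart_dom p -> chart_inv (chart_map p) = p;
  chart_invK : forall v, chart_im v -> chart_map (chart_inv v) = v;
  chart_map_cont : forall p, chart_dom p -> {for p, continuous chart_map};
  chart_inv_cont : forall v, chart_im v -> {for v, continuous chart_inv}
}.

Record manifold (R : realType) (m : nat) := Manifold {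
  carrier :> topologicalType;
  atlas : set (chart R m carrier);
  manifold_hausdorff : hausdorff_space carrier;
  manifold_second_countable : @second_countable carrier;
  atlas_cover : forall p : carrier, exists2 c, atlas c & chart_dom c p;
  atlas_compat : forall c d, atlas c -> atlas d ->
    smooth_on [set v | chart_im c v /\ chart_dom d (chart_inv c v)]
              (d \o chart_inv c)
}.

Definition chart_at (R : realType) (m : nat) (M : manifold R m) (p : M)
  (c : chart R m M) : Prop := atlas c /\ chart_dom c p.

Section ProductChart.
Variables (R : realType) (m : nat) (M : manifold R m) (c d : chart R m M).

Definition chart2_im : set 'rV[R]_(m + m) :=
  [set v | chart_im c (lsubmx v) /\ chart_im d (rsubmx v)].

Definition chart2_map (p : M * M) : 'rV[R]_(m + m) :=
  row_mx (c p.1) (d p.2).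

Definition chart2_inv (v : 'rV[R]_(m + m)) : M * M :=
  (chart_inv c (lsubmx v), chart_inv d (rsubmx v)).

End ProductChart.

(* Tangent vectors and covectors are row vectors of coordinates in a chart.
   A bilinear form, or equivalently a map E -> F^*, is represented by the
   matrix Q with <Q u, v> = u *m Q *m v^T, so that the map is u |-> u *m Q and
   its adjoint F -> E^* is v |-> v *m Q^T. *)
Section Lagrangian.
Variables (R : realType) (m : nat) (M : manifold R m) (L : M * M -> R).

Definition smooth_lagrangian : Prop :=
  forall c d : chart R m M, atlas c -> atlas d ->
    smooth_on (chart2_im c d) (L \o chart2_inv c d).

(* In these four, [c] is a chart at the point being differentiated at. *)
Definition dL1 (c : chart R m M) (x y : M) : 'rV[R]_m :=
  grad (fun v => L (chart_inv c v, y)) (c x).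

Definition dL2 (c : chart R m M) (x y : M) : 'rV[R]_m :=
  grad (fun w => L (x, chart_inv c w)) (c y).

Definition dL11 (c : chart R m M) (x y : M) : 'M[R]_m :=
  hessian (fun v => L (chart_inv c v, y)) (c x).

Definition dL22 (c : chart R m M) (x y : M) : 'M[R]_m :=
  hessian (fun w => L (x, chart_inv c w)) (c y).

Definition dL12 (c d : chart R m M) (x y : M) : 'M[R]_m :=
  \matrix_(a, b) 'D_(basis_vec R a)
    (fun v => 'D_(basis_vec R b)
      (fun w => L (chart_inv c v, chart_inv d w)) (d y)) (c x).

Definition twistB (c d : chart R m M) (x y : M) : 'M[R]_m := - dL12 c d x y.

(* Invertibility does not depend on the charts. *)
Definition twist (x y : M) : Prop :=
  forall c d, chart_at x c -> chart_at y d -> twistB c d x y \in unitmx.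

(* d_2 L(x,y) + d_1 L(y,z) = 0 in T_y^* M. *)
Definition euler_lagrange (x y z : M) : Prop :=
  forall c, chart_at y c -> dL2 c x y + dL1 c y z = 0.

Definition periodic_trajectory (n : nat) (x : int -> M) : Prop :=
  (forall i, x (i + n%:Z) = x i) /\
  (forall i, euler_lagrange (x (i - 1)) (x i) (x (i + 1))).

(* [T] is the branch near (x0,y0), with value (y0,z0) there, of the locally
   defined map (x,y) |-> (y,z). *)
Definition lagrangian_map_near (x0 y0 z0 : M) (T : M * M -> M * M) : Prop :=
  [/\ T (x0, y0) = (y0, z0),
      {for (x0, y0), continuous T} &
      \forall p \near (x0, y0),
        (T p).1 = p.2 /\ euler_lagrange p.1 p.2 (T p).2].

(* The equation may have several solutions z for the same (x,y), so the map
   is given by its branches along the trajectory, T i being the one near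
   (x i, x (i + 1)). The iterate T^k near (x 1, x 2) is then
   T k \o ... \o T 1. *)
Definition lagrangian_map_along (x : int -> M) (T : int -> M * M -> M * M) :
    Prop :=
  forall i, lagrangian_map_near (x i) (x (i + 1)) (x (i + 2)) (T i).

Fixpoint map_iter (T : int -> M * M -> M * M) (k : nat) : M * M -> M * M :=
  if k is k'.+1 then T k'.+1%:Z \o map_iter T k' else id.

(* Differential of T^n at the fixed point (x 1, x 2), in the chart
   c 1 x c 2 of M x M. *)
Definition poincare (c : int -> chart R m M) (n : nat) (x : int -> M)
    (T : int -> M * M -> M * M) : 'M[R]_(m + m) :=
  'J (chart2_map (c 1) (c 2) \o map_iter T n \o chart2_inv (c 1) (c 2))
     (chart2_map (c 1) (c 2) (x 1, x 2)).

Definition opA (c : int -> chart R m M) (x : int -> M) (i : int) : 'M[R]_m :=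
  dL22 (c i) (x (i - 1)) (x i) + dL11 (c i) (x i) (x (i + 1)).

Definition opB (c : int -> chart R m M) (x : int -> M) (i : int) : 'M[R]_m :=
  twistB (c i) (c (i + 1)) (x i) (x (i + 1)).

End Lagrangian.

(* The vector (u_1, ..., u_n) of X is the n x m matrix with rows u_j. Ordinals
   start at 0: j : 'I_n stands for the index j + 1. *)
Section TwistedOperators.
Variables (C : fieldType) (n m : nat).
Variables (A B : int -> 'M[C]_m) (rho : C).

(* u_{j-1}, where u_0 = rho^-1 u_n. *)
Definition uprev (u : 'M[C]_(n, m)) (j : 'I_n) : 'rV[C]_m :=
  if j == 0%N :> nat then rho^-1 *: row (ord_pred j) u
  else row (ord_pred j) u.

(* u_{j+1}, where u_{n+1} = rho u_1. *)
Definition unext (u : 'M[C]_(n, m)) (j : 'I_n) : 'rV[C]_m :=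
  if j.+1 == n then rho *: row (ordS j) u else row (ordS j) u.

Definition Hop (u : 'M[C]_(n, m)) : 'M[C]_(n, m) :=
  \matrix_(j < n) (row j u *m A j.+1%:Z - uprev u j *m B j%:Z
                   - unext u j *m (B j.+1%:Z)^T).

Definition Bop (u : 'M[C]_(n, m)) : 'M[C]_(n, m) :=
  \matrix_(j < n) (- (uprev u j *m B j%:Z)).

Definition detH : C := \det (lin_mx Hop).
Definition detB : C := \det (lin_mx Bop).

End TwistedOperators.

Definition complexify (R : realType) (p q : nat) (Q : 'M[R]_(p, q)) :
    'M[R[i]%C]_(p, q) := map_mx (real_complex R) Q.

(* Main.v *)
Require Import Defs.
From HB Require Import structures.
From mathcomp Require Import all_boot all_order all_algebra.
From mathcomp Require Import all_classical all_reals all_analysis.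
From mathcomp Require Import complex.
From mathcomp Require Import ring lra.
Import Order.TTheory GRing.Theory Num.Theory.
Import numFieldNormedType.Exports.
Set Implicit Arguments.
Unset Strict Implicit.
Unset Printing Implicit Defensive.
Local Open Scope classical_set_scope.
Local Open Scope ring_scope.

(** Write vectors as rows and let S_i be the matrix of the linearized step
    (u_i, u_(i+1)) |-> (u_(i+1), u_(i+2)), where
    u_(i+1) A_(i+1) - u_i B_i - u_(i+2) B_(i+1)^T = 0.
    The identity splits into an analytic and an algebraic part.

    Analysis: the linear Poincare map is P = S_1 S_2 .. S_n. Read in charts, a
    branch of the discrete Lagrangian map is a continuous solution of the
    Euler-Lagrange equation, whose derivative in the unknown point is
    invertible by the twist condition. Since continuity of the branch is
    given, only the differentiability half of the implicit function theorem is
    needed (has_jacobian_implicit); it yields S_i, once the mixed second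
    derivatives of the Lagrangian are known to commute (derive_comm). The chain
    rule then gives the product (has_jacobian_iter).

    Algebra: let N be the shift u_j |-> u_(j+1) with the twisted boundary
    condition u_(n+1) = rho u_1. From the definitions,
    B_rho^-1 H_rho u = u - (N u) X - (N^2 u) Y, where the blocks X and Y are
    the first block column of S^-1. Doubling the unknown to w_j = (u_j, u_(j+1))
    turns this second-order operator into w - (N w) S^-1 without changing the
    determinant (detL_pairs), and eliminating w_n, w_(n-1), .. in turn around
    the cycle reduces the determinant of the latter to that of
    1 - rho S_n^-1 .. S_1^-1 = 1 - rho P^-1 (detL_cyclic). Both reductions use
    only det(1 - FG) = det(1 - GF), so that no signs occur. Finally
    det S_i = det B_i / det B_(i+1), hence det P = 1 by periodicity, and
    det(P - rho) = det P det(1 - rho P^-1) = det H_rho / det B_rho. *)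

(** * Determinants of endomorphisms of matrix spaces *)

(** Sylvester's determinant identity. *)
Lemma det_1subM (C : comPzRingType) (m n : nat) (X : 'M[C]_(m, n))
    (Y : 'M[C]_(n, m)) :
  \det (1%:M - X *m Y) = \det (1%:M - Y *m X).
Proof.
have E1 : block_mx 1%:M X Y 1%:M
    = block_mx 1%:M 0 Y 1%:M *m block_mx 1%:M X 0 (1%:M - Y *m X).
  by rewrite mulmx_block !mul1mx !mul0mx !mulmx1 ?mulmx0 !addr0 addrC subrK.
have E2 : block_mx 1%:M X Y 1%:M
    = block_mx (1%:M - X *m Y) X 0 1%:M *m block_mx 1%:M 0 Y 1%:M.
  by rewrite mulmx_block !mul1mx !mul0mx !mulmx1 ?mulmx0 !add0r subrK.
have /(congr1 determinant) := etrans (esym E1) E2.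
by rewrite !det_mulmx !(det_ublock, det_lblock) !det1 !mul1r !mulr1.
Qed.

Lemma linear_1sub (C : pzRingType) (V : lmodType C) (f : V -> V) :
  linear f -> linear (fun w => w - f w).
Proof. by move=> lf a u v; rewrite lf scalerBr opprD addrACA. Qed.

Section DetLin.
Variable C : comPzRingType.

Lemma row_lin1_mx (p q : nat) (f : 'rV[C]_p -> 'rV[C]_q) (i : 'I_p) :
  row i (lin1_mx f) = f (delta_mx 0 i).
Proof. by apply/rowP => j; rewrite !mxE. Qed.

Lemma lin1_mx_comp (p q r : nat) (f : 'rV[C]_p -> 'rV[C]_q)
    (g : 'rV[C]_q -> 'rV[C]_r) :
  linear g -> lin1_mx (g \o f) = lin1_mx f *m lin1_mx g.
Proof.
move=> lg; pose gL : {linear 'rV[C]_q -> 'rV[C]_r} :=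
  HB.pack g (GRing.isLinear.Build _ _ _ _ g lg).
apply/row_matrixP => i; rewrite row_mul !row_lin1_mx /=.
by rewrite (mul_rV_lin1 gL).
Qed.

Lemma lin1_mxB (p : nat) (f : 'rV[C]_p -> 'rV[C]_p) :
  lin1_mx (fun u => u - f u) = 1%:M - lin1_mx f.
Proof.
by apply/matrixP => i j; rewrite !mxE eqxx eq_sym.
Qed.

(** The determinant of an endomorphism of the space of p x q matrices. The
    definition makes sense for any function, through its values on the standard
    basis; linearity is assumed only where it is needed. *)
Definition detL (p q : nat) (f : 'M[C]_(p, q) -> 'M[C]_(p, q)) : C :=
  \det (lin_mx f).

Lemma mxvec_linear (p q r s : nat) (f : 'M[C]_(p, q) -> 'M[C]_(r, s)) :
  linear f -> linear (mxvec \o f \o vec_mx).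
Proof. by move=> lf a u v; rewrite /= linearP lf linearP. Qed.

Lemma detL_comp (p q : nat) (f g : 'M[C]_(p, q) -> 'M[C]_(p, q)) :
  linear g -> detL (g \o f) = detL f * detL g.
Proof.
move=> lg; rewrite /detL -det_mulmx /lin_mx -lin1_mx_comp; last first.
  exact: mxvec_linear.
by congr (\det _); apply/matrixP => i j; rewrite !mxE /= mxvecK.
Qed.

Lemma eq_detL (p q : nat) (f g : 'M[C]_(p, q) -> 'M[C]_(p, q)) :
  f =1 g -> detL f = detL g.
Proof. by move=> fg; congr (\det _); apply/matrixP => i j; rewrite !mxE /= fg. Qed.

Lemma detL_id (p q : nat) : detL (@id 'M[C]_(p, q)) = 1.
Proof.
rewrite -(det1 C (p * q)); congr (\det _); apply/matrixP => i j.
by rewrite !mxE /= vec_mxK mxE eqxx eq_sym.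
Qed.

(** Sylvester's identity for linear maps between two matrix spaces. *)
Lemma detL_1subM (p q r s : nat) (f : 'M[C]_(p, q) -> 'M[C]_(r, s))
    (g : 'M[C]_(r, s) -> 'M[C]_(p, q)) :
  linear f -> linear g ->
  detL (fun u => u - g (f u)) = detL (fun w => w - f (g w)).
Proof.
move=> lf lg; rewrite /detL /lin_mx.
have E (a b : nat) (h : 'M[C]_(a, b) -> 'M[C]_(a, b)) :
    lin1_mx (mxvec \o (fun u => u - h u) \o vec_mx)
    = 1%:M - lin1_mx (mxvec \o h \o vec_mx).
  rewrite -lin1_mxB; apply/matrixP => i j; rewrite !mxE /=.
  by rewrite linearB /= vec_mxK !mxE.
rewrite (E _ _ (g \o f)) (E _ _ (f \o g)).
have D (a b c d e h : nat) (f1 : 'M[C]_(a, b) -> 'M[C]_(c, d))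
    (g1 : 'M[C]_(c, d) -> 'M[C]_(e, h)) : linear g1 ->
    lin1_mx (mxvec \o (g1 \o f1) \o vec_mx) =
    lin1_mx (mxvec \o f1 \o vec_mx) *m lin1_mx (mxvec \o g1 \o vec_mx).
  move=> lg1; rewrite -lin1_mx_comp; last exact: mxvec_linear.
  by apply/matrixP => i j; rewrite !mxE /= mxvecK.
by rewrite (D _ _ _ _ _ _ f g lg) (D _ _ _ _ _ _ g f lf) det_1subM.
Qed.

Lemma detL_1subM_rV (p q k : nat) (f : 'M[C]_(p, q) -> 'rV[C]_k)
    (g : 'rV[C]_k -> 'M[C]_(p, q)) :
  linear f -> linear g ->
  detL (fun u => u - g (f u)) = \det (1%:M - lin1_mx (f \o g)).
Proof.
move=> lf lg; rewrite /detL.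
have lf' : linear (f \o vec_mx) by move=> a u v; rewrite /= linearP lf.
have lg' : linear (mxvec \o g) by move=> a u v; rewrite /= lg linearP.
have -> : lin1_mx (f \o g) = lin1_mx (mxvec \o g) *m lin1_mx (f \o vec_mx).
  by rewrite -lin1_mx_comp //; apply/matrixP => i j; rewrite !mxE /= mxvecK.
rewrite -det_1subM -lin1_mx_comp // -lin1_mxB; congr (\det _).
by apply/matrixP => i j; rewrite !mxE /= linearB /= vec_mxK !mxE.
Qed.

End DetLin.

(** * Cyclic first-order systems *)

Section CyclicProduct.
Variables (C : fieldType) (n' k : nat) (rho : C).
Local Notation n := n'.+1.

(** The twisted shifts u_j |-> u_(j+1) and u_j |-> u_(j-1) of a sequence of n
    vectors, with u_(n+1) = rho u_1 and u_0 = rho^-1 u_n. *)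
Definition tnext (l : nat) (u : 'M[C]_(n, l)) : 'M[C]_(n, l) :=
  \matrix_(j < n) unext rho u j.
Definition tprev (l : nat) (u : 'M[C]_(n, l)) : 'M[C]_(n, l) :=
  \matrix_(j < n) uprev rho u j.

(** Multiplication of the j-th vector by its own matrix R_j. As the rows of the
    n x l matrix, the vectors are counted from 0. *)
Definition rowmul (l l' : nat) (R : nat -> 'M[C]_(l, l')) (u : 'M[C]_(n, l)) :
    'M[C]_(n, l') := \matrix_(j < n) (row j u *m R j).

Lemma tnext_linear l : linear (@tnext l).
Proof.
move=> a u v; apply/row_matrixP => j; rewrite linearP /= !rowK /unext.
case: ifP => _; rewrite linearP //= scalerDr !scalerA; congr (_ *: _ + _).
by rewrite mulrC.
Qed.

Lemma tprev_linear l : linear (@tprev l).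
Proof.
move=> a u v; apply/row_matrixP => j; rewrite linearP /= !rowK /uprev.
case: ifP => _; rewrite linearP //= scalerDr !scalerA; congr (_ *: _ + _).
by rewrite mulrC.
Qed.

Lemma rowmul_linear l l' (R : nat -> 'M[C]_(l, l')) : linear (rowmul R).
Proof.
move=> a u v; apply/row_matrixP => j; rewrite linearP /= !rowK.
by rewrite linearP /= mulmxDl scalemxAl.
Qed.

Variable R : nat -> 'M[C]_k.

(** The product R_(n-1) R_(n-2) .. R_(n-d). *)
Fixpoint bprod (d : nat) : 'M[C]_k :=
  if d is d'.+1 then bprod d' *m R (n - d) else 1%:M.

(** The untwisted shift followed by rowmul R, truncated to the first i rows; it
    is strictly triangular for i < n, so w |-> w - ushift i w is unipotent. *)
Definition ushift (i : nat) (w : 'M[C]_(n, k)) : 'M[C]_(n, k) :=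
  \matrix_(j < n) (if (j < i)%N then row (inord j.+1) w *m R j else 0).

Lemma ushift_linear i : linear (ushift i).
Proof.
move=> a u v; apply/row_matrixP => j; rewrite linearP /= !rowK.
case: ifP => _; last by rewrite scaler0 addr0.
by rewrite linearP /= mulmxDl scalemxAl.
Qed.

Lemma detL_1sub_ushift i : (i <= n')%N -> detL (fun w => w - ushift i w) = 1.
Proof.
elim: i => [_|i IHi lt_in].
  rewrite -[RHS](detL_id _ n k); apply: eq_detL => w; apply/row_matrixP => j.
  by rewrite linearB /= rowK /= subr0.
(* Adding row i amounts to composing with 1 - g f, where f reads row i + 1 and
   g writes row i, so that f g = 0. *)
pose f (w : 'M[C]_(n, k)) : 'rV[C]_k := row (inord i.+1) w *m R i.
pose g (v : 'rV[C]_k) : 'M[C]_(n, k) :=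
  \matrix_(j < n) (if j == i :> nat then v else 0).
have lf : linear f.
  by move=> a u v; rewrite /f linearP /= mulmxDl scalemxAl.
have lg : linear g.
  move=> a u v; apply/row_matrixP => j; rewrite linearP /= !rowK.
  by case: ifP; rewrite ?scaler0 ?addr0.
have lfg : linear (fun w => w - g (f w)).
  by apply: linear_1sub => a u v; rewrite lf lg.
have -> : detL (fun w => w - ushift i.+1 w)
    = detL ((fun w => w - g (f w)) \o (fun w => w - ushift i w)).
  apply: eq_detL => w /=; rewrite -addrA -opprD; congr (_ - _).
  have fU : f (ushift i w) = 0.
    by rewrite /f rowK inordK // ltnNge leqnSn /= mul0mx.
  have -> : f (w - ushift i w) = f w.
    by have := lf (-1) (ushift i w) w; rewrite fU scaler0 add0r scaleN1r addrC.
  apply/row_matrixP => j; rewrite linearD /= !rowK.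
  case: (ltngtP j i) => ji; rewrite ltnS.
  - by rewrite ltnW // addr0.
  - by rewrite leqNgt ji addr0.
  - by rewrite ji leqnn add0r /f.
rewrite (detL_comp _ lfg) (IHi (ltnW lt_in)) mul1r (detL_1subM_rV lf lg).
have -> : lin1_mx (f \o g) = 0.
  apply/row_matrixP => j; rewrite row_lin1_mx row0 /= /f rowK inordK //.
  by rewrite gtn_eqF // mul0mx.
by rewrite subr0 det1.
Qed.

(** The determinant of the cyclic system w_j - w_(j+1) R_j is that of the
    monodromy equation for its first vector. *)
Lemma detL_cyclic :
  detL (fun w => w - rowmul R (tnext w)) = \det (1%:M - rho *: bprod n).
Proof.
(* g v solves w_j = w_(j+1) R_j backwards from w_(n+1) = rho v; the last row is
   the only one where the twisted system differs from the triangular one. *)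
pose g (v : 'rV[C]_k) : 'M[C]_(n, k) :=
  \matrix_(j < n) (rho *: (v *m bprod (n - j))).
have lg : linear g.
  move=> a u v; apply/row_matrixP => j; rewrite linearP /= !rowK.
  by rewrite mulmxDl scalerDr -scalemxAl !scalerA mulrC.
have lf : linear (@row C n k ord0) by move=> a u v; rewrite linearP.
have lU : linear (fun w => w - ushift n' w) := linear_1sub (ushift_linear n').
have -> : detL (fun w => w - rowmul R (tnext w)) =
  detL ((fun w => w - ushift n' w) \o (fun w => w - g (row ord0 w))).
  apply: eq_detL => w /=; set v := row ord0 w.
  have -> (a : 'M[C]_(n, k)) : a - g v - ushift n' (a - g v) =
     (a - ushift n' a) - (g v - ushift n' (g v)).
    have := lU (-1) (g v) a.
    by rewrite !scaleN1r ![- _ + a]addrC => ->; rewrite addrC.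
  rewrite -addrA -opprD; congr (_ - _); apply/row_matrixP => j.
  rewrite !linearD linearN /= !rowK /unext.
  have [jn|jn] := ltnP j n'.
    rewrite eqn_leq (leqNgt n) ltnS ltnS jn andbF.
    have -> : ordS j = inord j.+1.
      by apply/val_inj; rewrite /= inordK // modn_small.
    rewrite inordK // subSn; last by rewrite ltnW.
    rewrite subSS /= subSS subKn; last exact: ltnW.
    by rewrite -scalemxAl mulmxA subrr addr0.
  have jE : j = n' :> nat by apply/eqP; rewrite eqn_leq jn -ltnS ltn_ord.
  have -> : ordS j = ord0 by apply/val_inj; rewrite /= jE modnn.
  rewrite jE eqxx subSnn add0r subr0 /= mul1mx subSS subn0.
  by rewrite -scalemxAl.
rewrite (detL_comp _ lU) detL_1sub_ushift // mulr1 (detL_1subM_rV lf lg).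
congr (\det (_ - _)); apply/row_matrixP => j.
by rewrite row_lin1_mx /= rowK subn0 linearZ /= -rowE.
Qed.

End CyclicProduct.

(** * The algebraic identity for the transfer matrices *)

Section TransferMatrix.
Variables (C : fieldType) (n' m : nat) (A B : int -> 'M[C]_m) (rho : C).
Local Notation n := n'.+1.
Hypotheses (rho_neq0 : rho != 0) (B_unit : forall i, B i \in unitmx).
Hypothesis A_per : forall i : int, A (i + n%:Z) = A i.
Hypothesis B_per : forall i : int, B (i + n%:Z) = B i.

Lemma tnextK l : cancel (@tnext C n' rho l) (@tprev C n' rho l).
Proof.
move=> u; apply/row_matrixP => j; rewrite rowK /uprev rowK /unext.
have [j0|j0] := eqVneq (nat_of_ord j) 0%N.
  have -> : (ord_pred j).+1 = n by rewrite /= j0 /= modn_small.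
  by rewrite eqxx scalerA mulVf // scale1r ord_predK.
rewrite ord_predK /= -{1}(prednK (n := j)) ?lt0n // addSn /=.
rewrite modnDr modn_small ?prednK ?lt0n //; last exact: ltnW.
by rewrite ltn_eqF.
Qed.

(** Shifting back the sequence w_i Q_i; periodicity of Q is what makes this
    hold across the end of the period. *)
Lemma tprev_rowmul (l l' : nat) (Q : int -> 'M[C]_(l, l')) (w : 'M[C]_(n, l)) :
  (forall i, Q (i + n%:Z) = Q i) ->
  tprev rho (rowmul (fun j => Q j.+1%:Z) w)
  = rowmul (fun j => Q j%:Z) (tprev rho w).
Proof.
move=> Q_per; apply/row_matrixP => j; rewrite !rowK /uprev !rowK.
have [j0|j0] := eqVneq (nat_of_ord j) 0%N.
  have -> : (ord_pred j).+1 = n by rewrite /= j0 /= modn_small.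
  by rewrite j0 -[in RHS]Q_per add0r scalemxAl.
have -> // : (ord_pred j).+1 = j.
rewrite /= -{1}(prednK (n := j)) ?lt0n // addSn /=.
by rewrite modnDr modn_small ?prednK ?lt0n // ltnW.
Qed.

Lemma Bop_linear : linear (@Bop C n m B rho).
Proof.
move=> a u v; apply/row_matrixP => j; rewrite linearP /= !rowK.
have := congr1 (row j) (@tprev_linear C n' rho m a u v).
rewrite linearP /= !rowK => ->.
by rewrite mulmxDl opprD -scalemxAl scalerN.
Qed.

Lemma detB_neq0 : detB n B rho != 0.
Proof.
pose Binv (u : 'M[C]_(n, m)) : 'M[C]_(n, m) :=
  - tnext rho (rowmul (fun j => invmx (B j%:Z)) u).
have : detL (@Bop C n m B rho \o Binv) = 1.
  rewrite -(detL_id C n m); apply: eq_detL => u /=; apply/row_matrixP => j.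
  have E : row j (tprev rho (Binv u)) = - (row j u *m invmx (B j%:Z)).
    have := tprev_linear rho (-1) (tnext rho (rowmul (fun j => invmx (B j%:Z)) u)) 0.
    rewrite /Binv addr0 !scaleN1r tnextK => ->.
    have -> : tprev rho (0 : 'M[C]_(n, m)) = 0.
      apply/row_matrixP => i; rewrite !rowK /uprev row0.
      by case: ifP => _; rewrite ?scaler0 row0.
    by rewrite addr0 linearN /= rowK.
  by move: E; rewrite !rowK => ->; rewrite mulNmx opprK mulmxKV.
rewrite detL_comp; last exact: Bop_linear.
by move=> /eqP; apply: contraTneq => dB; rewrite /detL -/(detB n B rho) dB mulr0 eq_sym oner_eq0.
Qed.

(** The matrix of (u_i, u_(i+1)) |-> (u_(i+1), u_(i+2)), where u_(i+2) solves
    the linearized equation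
    u_(i+1) A_(i+1) - u_i B_i - u_(i+2) B_(i+1)^T = 0. *)
Definition transfer (i : int) : 'M[C]_(m + m) :=
  block_mx 0 (- (B i *m invmx (B (i + 1))^T))
           1%:M (A (i + 1) *m invmx (B (i + 1))^T).

(** The product S_1 S_2 .. S_k of the transfer matrices. *)
Fixpoint transfer_prod (k : nat) : 'M[C]_(m + m) :=
  if k is k'.+1 then transfer_prod k' *m transfer k'.+1%:Z else 1%:M.

(* transfer i has inverse block_mx (X i) 1%:M (Y i) 0. Xn, Yn and Rn shift the
   index by one, as row j of a sequence stands for the index j + 1. *)
Let X (i : int) := A (i + 1) *m invmx (B i).
Let Y (i : int) := - ((B (i + 1))^T *m invmx (B i)).
Let Xn (j : nat) := X j.+1%:Z.
Let Yn (j : nat) := Y j.+1%:Z.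
Let Rn (j : nat) : 'M[C]_(m + m) := block_mx (Xn j) 1%:M (Yn j) 0.

Lemma transferK i : transfer i *m block_mx (X i) 1%:M (Y i) 0 = 1%:M.
Proof.
rewrite /transfer /X /Y mulmx_block !mul0mx !mul1mx !mulmx0 !addr0 !add0r.
rewrite mulmxN mulNmx opprK !mulmxA mulmxKV ?unitmx_tr // mulmxV //.
rewrite mulmxN !mulmxA mulmxKV ?unitmx_tr // subrr.
by rewrite -scalar_mx_block.
Qed.

Lemma det_transfer i : \det (transfer i) = \det (B i) / \det (B (i + 1)).
Proof.
pose J : 'M[C]_(m + m) := block_mx 0 1%:M (- 1%:M) 0.
have dJ : \det J = 1.
  (* rotation by a right angle as a product of three shears *)
  have -> : J = block_mx 1%:M 1%:M 0 1%:M *m block_mx 1%:M 0 (- 1%:M) 1%:M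
                *m block_mx 1%:M 1%:M 0 1%:M.
    by rewrite !mulmx_block !mulmx1 !mul1mx !mul0mx !mulmx0 ?addr0 ?add0r
               subrr addNr ?add0r.
  by rewrite !det_mulmx !det_ublock det_lblock !det1 !mulr1.
rewrite -[LHS]mulr1 -dJ -det_mulmx /transfer /J mulmx_block.
rewrite !mulmx0 !mul0mx !mulmxN !mulmx1 opprK ?addr0 ?add0r det_lblock det1 mulr1.
by rewrite det_mulmx det_inv det_tr.
Qed.

Lemma det_transfer_prod k :
  \det (transfer_prod k) = \det (B 1) / \det (B k.+1%:Z).
Proof.
have dB i : \det (B i) != 0 by rewrite -unitfE -unitmxE.
elim: k => [|k IHk]; first by rewrite det1 divff.
rewrite /= det_mulmx IHk det_transfer -(PoszD k.+1 1) addn1.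
by rewrite mulrA divfK.
Qed.

(** bprod n' Rn d undoes the last d of the n transfer steps. *)
Lemma transfer_prod_bprod d : (d <= n)%N ->
  transfer_prod n *m bprod n' Rn d = transfer_prod (n - d).
Proof.
elim: d => [|d IHd] dn; first by rewrite mulmx1 subn0.
rewrite [bprod _ _ _]/= mulmxA IHd; last exact: ltnW.
have E : (n - d = (n - d.+1).+1)%N by rewrite subnSK.
rewrite E [transfer_prod _.+1]/= -mulmxA.
by rewrite /Rn /Xn /Yn transferK mulmx1.
Qed.

(** The right-hand side is the determinant of B_rho^-1 H_rho:
    (B_rho^-1 H_rho u)_i = u_i - u_(i+1) X_i - u_(i+2) Y_i. *)
Lemma detH_div_detB :
  detH n A B rho / detB n B rho =
  detL (fun u : 'M[C]_(n, m) => u - rowmul Xn (tnext rho u)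
                     - rowmul Yn (tnext rho (tnext rho u))).
Proof.
set K := (fun u => _).
have perX i : X (i + n%:Z) = X i.
  by rewrite /X addrAC A_per B_per.
have perY i : Y (i + n%:Z) = Y i.
  by rewrite /Y addrAC !B_per.
have -> : detH n A B rho = detL (@Bop C n m B rho \o K).
  apply: eq_detL => u /=; apply/row_matrixP => j; rewrite !rowK.
  have E : row j (tprev rho (K u)) =
     uprev rho u j - row j u *m X j - unext rho u j *m Y j.
    rewrite /K; have tB (a b : 'M[C]_(n, m)) :
        tprev rho (a - b) = tprev rho a - tprev rho b.
      by rewrite addrC -scaleN1r tprev_linear scaleN1r addrC.
    rewrite !tB (tprev_rowmul _ perX) (tprev_rowmul _ perY) !tnextK.
    by rewrite !linearB /= !rowK.
  move: E; rewrite rowK => ->.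
  have -> : j.+1%:Z = j%:Z + 1 by rewrite -addn1 PoszD.
  rewrite !mulmxBl !opprB /X /Y mulmxN mulNmx.
  rewrite !mulmxA !mulmxKV //.
  by rewrite addrC.
rewrite detL_comp; last exact: Bop_linear.
by rewrite mulfK // detB_neq0.
Qed.

(** Reduction of order: the first-order system for the pairs
    w_j = (u_j, u_(j+1)) has the same determinant as the second-order one. *)
Lemma detL_pairs :
  detL (fun w : 'M[C]_(n, m + m) => w - rowmul Rn (tnext rho w)) =
  detL (fun u : 'M[C]_(n, m) => u - rowmul Xn (tnext rho u)
                     - rowmul Yn (tnext rho (tnext rho u))).
Proof.
(* The map w - (N w) R is (1 - ia h) (1 - ib pa), where pa ib = 0 and
   1 - h ia is the second-order operator. *)
pose ia (a : 'M[C]_(n, m)) : 'M[C]_(n, m + m) := row_mx a 0.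
pose ib (a : 'M[C]_(n, m)) : 'M[C]_(n, m + m) := row_mx 0 (tnext rho a).
pose pa (w : 'M[C]_(n, m + m)) : 'M[C]_(n, m) := lsubmx w.
pose h (w : 'M[C]_(n, m + m)) : 'M[C]_(n, m) :=
  rowmul Xn (tnext rho (lsubmx w)) +
  rowmul Yn (tnext rho (rsubmx w + tnext rho (lsubmx w))).
have l_ia : linear ia.
  by move=> a u v; rewrite /ia scale_row_mx add_row_mx scaler0 addr0.
have l_ib : linear ib.
  by move=> a u v; rewrite /ib tnext_linear scale_row_mx add_row_mx scaler0 addr0.
have l_pa : linear pa by move=> a u v; rewrite /pa linearP.
have l_q : linear (fun w : 'M[C]_(n, m + m) => rsubmx w + tnext rho (lsubmx w)).
  by move=> a u v; rewrite !linearP /= tnext_linear scalerDr addrACA.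
have l_h : linear h.
  move=> a u v; rewrite /h l_q linearP /= !tnext_linear !rowmul_linear.
  by rewrite scalerDr addrACA.
have -> : detL (fun w : 'M[C]_(n, m + m) => w - rowmul Rn (tnext rho w)) =
   detL ((fun w => w - ia (h w)) \o (fun w => w - ib (pa w))).
  apply: eq_detL => w /=.
  have -> : h (w - ib (pa w)) =
      rowmul Xn (tnext rho (lsubmx w)) + rowmul Yn (tnext rho (rsubmx w)).
    by rewrite /h /ib /pa !linearB /= row_mxKl row_mxKr subr0 subrK.
  rewrite -addrA -opprD; congr (_ - _); rewrite /ib /ia add_row_mx add0r addr0.
  apply/row_matrixP => j; rewrite row_row_mx rowK linearD /= !rowK.
  have -> : unext rho w j = row_mx (unext rho (lsubmx w) j) (unext rho (rsubmx w) j).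
    rewrite /unext -[in LHS](hsubmxK w) row_row_mx.
    by case: ifP => _ //; rewrite scale_row_mx.
  by rewrite mul_row_block !mulmx1 mulmx0 addr0 addrC.
have l_iah : linear (fun w => w - ia (h w)).
  by apply: linear_1sub => a u v; rewrite (l_h a u v) (l_ia a (h u)).
rewrite (detL_comp _ l_iah) (detL_1subM l_pa l_ib) (detL_1subM l_h l_ia).
have -> : detL (fun a => a - pa (ib a)) = 1.
  rewrite -(detL_id C n m); apply: eq_detL => a.
  by rewrite /pa /ib row_mxKl subr0.
rewrite mul1r; apply: eq_detL => a.
by rewrite /h /ia row_mxKl row_mxKr add0r opprD addrA.
Qed.

Lemma det_transfer_prod_sub :
  \det (transfer_prod n - rho%:M) = detH n A B rho / detB n B rho.
Proof.
rewrite detH_div_detB -detL_pairs detL_cyclic.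
have dT : \det (transfer_prod n) = 1.
  rewrite det_transfer_prod; have -> : n.+1%:Z = 1 + n%:Z by rewrite -PoszD.
  by rewrite B_per divff // -unitfE -unitmxE.
transitivity (\det (transfer_prod n) * \det (1%:M - rho *: bprod n' Rn n)).
  rewrite -det_mulmx mulmxBr mulmx1 -scalemxAr transfer_prod_bprod // subnn.
  by rewrite scalemx1.
by rewrite dT mul1r.
Qed.

End TransferMatrix.

(** * Jacobian matrices and implicit differentiation *)

Section FiniteDimensionalCalculus.
Variable R : realType.

Lemma rV_linear_continuous (p : nat) (W : normedModType R)
    (f : {linear 'rV[R]_p -> W}) : continuous f.
Proof.
have -> : (f : 'rV[R]_p -> W) = (fun v => \sum_i v 0 i *: f (delta_mx 0 i)).
  apply/funext => v; rewrite {1}[v]row_sum_delta linear_sum /=.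
  by apply: eq_bigr => i _; rewrite linearZ.
apply: continuous_big => [|i _]; first exact: add_continuous.
move=> v; apply: (@cvgZr_tmp _ _ _ (nbhs v) (nbhs_filter v)).
exact: (@coord_continuous R 1 p 0 i v).
Qed.

Lemma differentiable_le (V W : normedModType R) (f : V -> W) (x : V) :
  differentiable f x -> forall e, 0 < e ->
  \forall v \near x, `|f v - f x - 'd f x (v - x)| <= e * `|v - x|.
Proof.
move=> /diff_locally /eqaddoP df e e0.
have := df _ e0; rewrite near_simpl [X in _ -> X](near_shift 0) subr0 => H.
apply: filter_app H; near=> h; rewrite /= addrK.
by rewrite opprD addrA.
Unshelve. all: by end_near. Qed.

Lemma differentiable_of_le (V W : normedModType R) (f : V -> W) (x : V)
    (df : {linear V -> W}) : continuous df ->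
  (forall e, 0 < e ->
   \forall v \near x, `|f v - f x - df (v - x)| <= e * `|v - x|) ->
  differentiable f x /\ 'd f x = df :> (V -> W).
Proof.
move=> cdf H.
have E : f \o shift x = cst (f x) + df +o_ 0 id.
  apply/eqaddoP => e e0.
  have := H _ e0; rewrite [X in X -> _](near_shift 0) subr0 => {}H.
  rewrite near_simpl; apply: filter_app H; near=> h; rewrite /= addrK.
  by rewrite opprD addrA.
have dfE := diff_unique cdf E.
by split=> //; apply/diff_locallyP; rewrite dfE.
Unshelve. all: by end_near. Qed.

End FiniteDimensionalCalculus.

Section Jacobians.
Variable R : realType.

(** f is differentiable at x with Jacobian matrix Q; vectors are rows, so that
    the differential is h |-> h Q. *)
Definition has_jacobian (p q : nat) (f : 'rV[R]_p -> 'rV[R]_q) (x : 'rV[R]_p)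
    (Q : 'M[R]_(p, q)) : Prop :=
  differentiable f x /\ 'J f x = Q.

Lemma has_jacobianP (p q : nat) (f : 'rV[R]_p -> 'rV[R]_q) x Q :
  has_jacobian f x Q <-> forall e, 0 < e ->
    \forall v \near x, `|f v - f x - (v - x) *m Q| <= e * `|v - x|.
Proof.
split=> [[df <-] e e0|H].
  have := differentiable_le df e0; apply: filter_app; near=> v.
  by rewrite /jacobian mul_rV_lin1.
have [df E] := @differentiable_of_le _ _ _ f x (mulmxr Q) (@rV_linear_continuous _ _ _ _) H.
split=> //; apply/row_matrixP => i.
by rewrite !rowE /jacobian mul_rV_lin1 E.
Unshelve. all: by end_near. Qed.

Lemma has_jacobian_near (p q : nat) (f g : 'rV[R]_p -> 'rV[R]_q) x Q :
  (\forall v \near x, f v = g v) -> has_jacobian f x Q -> has_jacobian g x Q.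
Proof.
move=> fg /has_jacobianP H; apply/has_jacobianP => e /H.
have fgx := nbhs_singleton fg; apply: filter_app; move: fg; apply: filter_app.
by near=> v => -> ; rewrite fgx.
Unshelve. all: by end_near. Qed.

Lemma has_jacobian_comp (p q r : nat) (f : 'rV[R]_p -> 'rV[R]_q)
    (g : 'rV[R]_q -> 'rV[R]_r) x Q S :
  has_jacobian f x Q -> has_jacobian g (f x) S ->
  has_jacobian (g \o f) x (Q *m S).
Proof.
move=> [df <-] [dg <-]; split; first exact: differentiable_comp.
apply/row_matrixP => i; rewrite row_mul !rowE /jacobian !mul_rV_lin1.
by rewrite diff_comp.
Qed.

Lemma has_jacobian_mulmx (p q : nat) (Q : 'M[R]_(p, q)) x :
  has_jacobian (mulmxr Q) x Q.
Proof.
apply/has_jacobianP => e e0; near=> v.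
by rewrite /= mulmxBl subrr normr0 mulr_ge0 // ltW.
Unshelve. all: by end_near. Qed.

Lemma has_jacobian_add (p q : nat) (f g : 'rV[R]_p -> 'rV[R]_q) x Q S :
  has_jacobian f x Q -> has_jacobian g x S ->
  has_jacobian (fun v => f v + g v) x (Q + S).
Proof.
move=> [df <-] [dg <-].
have dfg : differentiable (fun v => f v + g v) x by exact: differentiableD.
split=> //; apply/row_matrixP => i; rewrite rowE -(deriveEjacobian _ dfg).
rewrite [RHS]rowE mulmxDr; set u := delta_mx 0 i.
transitivity ('D_u f x + 'D_u g x).
  by apply: deriveD; exact: diff_derivable.
congr (_ + _); exact: deriveEjacobian.
Qed.

Lemma has_jacobian_row (p q : nat) (g : 'I_q -> 'rV[R]_p -> R) x :
  (forall b, differentiable (g b) x) ->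
  has_jacobian (fun v => \row_b g b v) x
    (\matrix_(a, b) 'D_(basis_vec R a) (g b) x).
Proof.
move=> dg.
have E : (fun v => \row_b g b v) = (fun v => \sum_b (g b v *: delta_mx 0 b)).
  by apply/funext => v; rewrite [LHS]row_sum_delta; apply: eq_bigr => b _; rewrite mxE.
have dG : differentiable (fun v => \row_b g b v) x.
  have -> : (fun v => \row_b g b v) = \sum_b (fun v => g b v *: delta_mx 0 b).
    by rewrite E; apply/funext => v; rewrite fct_sumE.
  by apply: differentiable_sum => b; exact: differentiableZl.
split=> //; apply/matrixP => a b.
have Eb : (fun v => (\row_b g b v) 0 b) = g b by apply/funext => v; rewrite mxE.
rewrite [RHS]mxE -[in RHS]Eb.
transitivity (('D_(basis_vec R a) (fun v => \row_b g b v) x) 0 b).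
  by rewrite (deriveEjacobian (basis_vec R a) dG) -rowE [RHS]mxE.
rewrite derive_mx; last exact: diff_derivable.
by rewrite mxE.
Qed.

(** If Phi o t = Psi near a, t is continuous at a and Phi has an invertible
    differential at t a, then t inherits differentiability from Psi. This is
    the part of the implicit function theorem that needs no completeness. *)
Lemma has_jacobian_implicit (p q : nat) (t : 'rV[R]_p -> 'rV[R]_q)
    (Phi : 'rV[R]_q -> 'rV[R]_q) (Psi : 'rV[R]_p -> 'rV[R]_q) a Q K :
  {for a, continuous t} ->
  has_jacobian Phi (t a) Q -> Q \in unitmx -> has_jacobian Psi a K ->
  (\forall v \near a, Phi (t v) = Psi v) ->
  has_jacobian t a (K *m invmx Q).
Proof.
move=> ct /has_jacobianP dPhi uQ /has_jacobianP dPsi E.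
have [k k0 Hk] := linear_lipschitz (@rV_linear_continuous R q _ (mulmxr (invmx Q))).
have [l l0 Hl] := linear_lipschitz (@rV_linear_continuous R p _ (mulmxr (K *m invmx Q))).
apply/has_jacobianP => e e0.
pose M : R := 2 * (l + e / 2).
have M0 : 0 < M by rewrite mulr_gt0 // addr_gt0 // divr_gt0.
(* k d <= 1/2 bounds t v - t a by M |v - a|; k d M <= e/2 controls the error *)
pose d : R := Num.min (1 / 2) (e / 2 / M) / k.
have d0 : 0 < d by rewrite divr_gt0 // lt_min !divr_gt0.
have e10 : 0 < e / 2 / k by rewrite !divr_gt0.
have H1 := ct _ (dPhi _ d0); rewrite nbhs_simpl /= in H1.
move: (dPsi _ e10); apply: filter_app.
move: H1; apply: filter_app; have Ea := nbhs_singleton E.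
move: E; apply: filter_app; near=> v => Ev /=.
rewrite Ev Ea; set y := v - a; set D := t v - t a => H1 H2.
have H3 : `|D *m Q - y *m K| <= d * `|D| + e / 2 / k * `|y|.
  have -> : D *m Q - y *m K = (Psi v - Psi a - y *m K) - (Psi v - Psi a - D *m Q).
    by rewrite opprB [RHS]addrC subrKA.
  by rewrite (le_trans (ler_normB _ _)) // addrC lerD.
have H4 : `|D - y *m (K *m invmx Q)| <= k * d * `|D| + e / 2 * `|y|.
  have := Hk (D *m Q - y *m K); rewrite /= mulmxBl mulmxK // -mulmxA.
  move=> /le_trans; apply; rewrite (le_trans (ler_wpM2l (ltW k0) H3)) //.
  have kE : k * (e / 2 / k) = e / 2 by rewrite mulrC divfK ?gt_eqF.
  by rewrite mulrDr (mulrA k d) (mulrA k (e / 2 / k)) kE.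
have kdE : k * d = Num.min (1 / 2) (e / 2 / M).
  by rewrite /d mulrC divfK // gt_eqF.
have kd1 : k * d <= 1 / 2 by rewrite kdE ge_min lexx.
have kd2 : k * d * M <= e / 2 by rewrite -ler_pdivlMr // kdE ge_min lexx orbT.
have H5 := Hl y; rewrite /= in H5.
have H6 : `|D| <= `|D - y *m (K *m invmx Q)| + `|y *m (K *m invmx Q)|.
  by rewrite -{1}(subrK (y *m (K *m invmx Q)) D) ler_normD.
have H7 : `|D| <= M * `|y|.
  have : k * d * `|D| <= 1 / 2 * `|D| by rewrite ler_wpM2r.
  by rewrite /M; lra.
apply: (le_trans H4).
have H8 : k * d * `|D| <= k * d * (M * `|y|).
  by rewrite ler_wpM2l // mulr_ge0 // ltW.
have H9 : k * d * (M * `|y|) <= e / 2 * `|y| by rewrite mulrA ler_wpM2r.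
by rewrite [leRHS](_ : _ = e / 2 * `|y| + e / 2 * `|y|) ?lerD2r ?(le_trans H8) // -mulrDl -splitr.
Unshelve. all: by end_near. Qed.

End Jacobians.

(** * Symmetry of second derivatives *)

Section MixedDerivatives.
Variables (R : realType) (V : normedModType R).

Lemma is_derive_line (f : V -> R) (y h : V) (s : R) :
  derivable f (y + s *: h) h ->
  is_derive s 1 (fun r => f (y + r *: h)) ('D_h f (y + s *: h)).
Proof.
have E : (fun e : R => e^-1 *: (((fun r => f (y + r *: h)) \o shift s) (e *: 1)
                      - f (y + s *: h)))
       = (fun e : R => e^-1 *: ((f \o shift (y + s *: h)) (e *: h)
                      - f (y + s *: h))).
  apply/funext => e /=; congr (_ *: (f _ - _)).
  by rewrite [e *: 1]mulr1 scalerDl addrCA.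
move=> df; split; first by rewrite /derivable E.
by rewrite /derive E.
Qed.

(** Two applications of the mean value theorem to the second difference of f
    over a parallelogram with sides s h and s k. *)
Lemma second_difference (f : V -> R) (x h k : V) (s : R) : 0 < s ->
  (forall a b, 0 <= a <= s -> 0 <= b <= s ->
    derivable f (x + a *: h + b *: k) h /\
    derivable ('D_h f) (x + a *: h + b *: k) k) ->
  exists a b, [/\ 0 <= a <= s, 0 <= b <= s &
    f (x + s *: h + s *: k) - f (x + s *: h) - f (x + s *: k) + f x
    = s * s * 'D_k ('D_h f) (x + a *: h + b *: k)].
Proof.
move=> s0 H.
have s0s : 0 <= s <= s by rewrite lexx ltW.
have z0s : 0 <= (0 : R) <= s by rewrite lexx ltW.
pose phi r := f (x + s *: k + r *: h) - f (x + r *: h).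
pose dphi r := 'D_h f (x + s *: k + r *: h) - 'D_h f (x + r *: h).
have dphiP r : 0 <= r <= s -> is_derive r 1 phi (dphi r).
  move=> rs; apply: is_deriveB; apply: is_derive_line.
    rewrite addrAC; exact (H r s rs s0s).1.
  have := (H r 0 rs z0s).1; rewrite scale0r addr0 => K; exact K.
have [r||a a0s Ea] := @MVT R phi dphi 0 s s0.
- by rewrite in_itv /= => /andP[r0 rs]; apply: dphiP; rewrite !ltW.
- apply: derivable_within_continuous => r; rewrite in_itv /= => rs.
  have [K _] := dphiP r rs; exact K.
have {}a0s : 0 <= a <= s by move: a0s; rewrite in_itv /= => /andP[a0 as_]; rewrite !ltW.
pose psi r := 'D_h f (x + a *: h + r *: k).
have dpsiP r : 0 <= r <= s ->
    is_derive r 1 psi ('D_k ('D_h f) (x + a *: h + r *: k)).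
  move=> rs; apply: is_derive_line; exact (H a r a0s rs).2.
have [r||b b0s Eb] := @MVT R psi (fun r => 'D_k ('D_h f) (x + a *: h + r *: k)) 0 s s0.
- by rewrite in_itv /= => /andP[r0 rs]; apply: dpsiP; rewrite !ltW.
- apply: derivable_within_continuous => r; rewrite in_itv /= => rs.
  have [K _] := dpsiP r rs; exact K.
have {}b0s : 0 <= b <= s by move: b0s; rewrite in_itv /= => /andP[b0 bs]; rewrite !ltW.
exists a, b; split=> //.
move: Ea Eb; rewrite /phi /dphi /psi !scale0r !addr0 !subr0.
rewrite (addrAC x (s *: k)) => Ea Eb.
rewrite (addrAC x (s *: k)) in Ea.
rewrite Eb in Ea.
by rewrite mulrC mulrA -Ea opprD opprK addrA.
Qed.

(** Schwarz's theorem: second_difference, applied in both orders, expresses the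
    same second difference through either mixed derivative near x. *)
Lemma derive_comm (f : V -> R) (x h k : V) :
  (\forall y \near x, [/\ derivable f y h, derivable f y k,
     derivable ('D_h f) y k & derivable ('D_k f) y h]) ->
  {for x, continuous ('D_k ('D_h f))} ->
  {for x, continuous ('D_h ('D_k f))} ->
  'D_k ('D_h f) x = 'D_h ('D_k f) x.
Proof.
move=> N ckh chk; apply/eqP; rewrite -subr_eq0; apply: contraT => ne.
pose e := `|'D_k ('D_h f) x - 'D_h ('D_k f) x|.
have e0 : 0 < e by rewrite normr_gt0.
have e20 : 0 < e / 2 by rewrite divr_gt0.
have [d /= d0 Hd] : exists2 d : R, 0 < d & forall y, `|y - x| < d ->
   [/\ [/\ derivable f y h, derivable f y k,
     derivable ('D_h f) y k & derivable ('D_k f) y h],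
     `|'D_k ('D_h f) x - 'D_k ('D_h f) y| < e / 2 &
     `|'D_h ('D_k f) x - 'D_h ('D_k f) y| < e / 2].
  have : \forall y \near x,
   [/\ [/\ derivable f y h, derivable f y k,
     derivable ('D_h f) y k & derivable ('D_k f) y h],
     `|'D_k ('D_h f) x - 'D_k ('D_h f) y| < e / 2 &
     `|'D_h ('D_k f) x - 'D_h ('D_k f) y| < e / 2].
    have C1 := (cvgrPdist_lt _ _).1 ckh _ e20.
    have C2 := (cvgrPdist_lt _ _).1 chk _ e20.
    have F : Filter (nbhs x) := nbhs_filter x.
    move: N (C1 F) (C2 F); apply: filterS3 => y Ny Cy Dy; exact (And3 Ny Cy Dy).
  move=> /nbhs_ballP [d d0 Hd]; exists d; [exact d0|move=> y yd; apply: Hd].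
  by rewrite -ball_normE /= distrC.
(* small enough for the parallelogram to stay in the ball of radius d; the
   summand 1 covers h = k = 0 *)
pose s := d / (2 * (`|h| + `|k| + 1)).
have N0 : 0 < 2 * (`|h| + `|k| + 1) by rewrite mulr_gt0 // ltr_wpDl // addr_ge0.
have s0 : 0 < s by rewrite divr_gt0.
have near_x a b : 0 <= a <= s -> 0 <= b <= s -> `|x + a *: h + b *: k - x| < d.
  move=> /andP[a0 as_] /andP[b0 bs].
  rewrite -(addrA x) [x + _]addrC addrK (le_lt_trans (ler_normD _ _)) // !normrZ !ger0_norm //.
  have aux (A B P Q r D : R) : A <= P -> B <= Q -> 0 <= P -> 0 <= Q -> 0 < r ->
      r * 2 + 2 * P + 2 * Q = D -> A + B < D by clear; move=> *; lra.
  apply: (aux _ _ (s * `|h|) (s * `|k|) s) => //.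
  - by rewrite ler_wpM2r.
  - by rewrite ler_wpM2r.
  - by rewrite mulr_ge0 // ltW.
  - by rewrite mulr_ge0 // ltW.
  have <- : s * (2 * (`|h| + `|k| + 1)) = d by rewrite divfK // gt_eqF.
  by clear; ring.
have [|a [b [aI bI E1]]] := @second_difference f x h k s s0.
  move=> a b aI bI; have [[Dh _ Dkh _] _ _] := Hd _ (near_x a b aI bI).
  exact (conj Dh Dkh).
have [|b' [a' [bI' aI' E2]]] := @second_difference f x k h s s0.
  move=> b' a' bI' aI'; rewrite addrAC.
  have [[_ Dk _ Dhk] _ _] := Hd _ (near_x a' b' aI' bI').
  exact (conj Dk Dhk).
have E : 'D_k ('D_h f) (x + a *: h + b *: k) = 'D_h ('D_k f) (x + a' *: h + b' *: k).
  have ss : s * s != 0 by rewrite mulf_neq0 // gt_eqF.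
  rewrite (addrAC x (b' *: k)) (addrAC x (s *: k)) in E2.
  apply: (mulfI ss); apply: etrans (esym E1) (etrans _ E2).
  exact (congr1 (+%R^~ (f x)) (addrAC _ _ _)).
have [_ H1 _] := Hd _ (near_x a b aI bI).
have [_ _ H2] := Hd _ (near_x a' b' aI' bI').
have tri (u v w r : R) : `|u - w| < r / 2 -> `|v - w| < r / 2 -> `|u - v| < r.
  clear=> uw vw; rewrite (splitr r) -(subrKA w); rewrite distrC in vw.
  exact: le_lt_trans (ler_normD _ _) (ltrD uw vw).
rewrite E in H1; have := tri _ _ _ _ H1 H2; rewrite -/e ltxx => K; exact K.
Qed.

End MixedDerivatives.

(** * Product charts *)

Section Charts.
Variables (R : realType) (m : nat).

Lemma derive_row_mxl (W : normedModType R) (g : 'rV[R]_(m + m) -> W)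
    (v w h : 'rV[R]_m) :
  'D_h (fun v => g (row_mx v w)) v = 'D_(row_mx h 0) g (row_mx v w).
Proof.
rewrite /derive.
have -> // : (fun e : R => e^-1 *: (((fun v => g (row_mx v w)) \o shift v) (e *: h) - g (row_mx v w))) =
    (fun e => e^-1 *: ((g \o shift (row_mx v w)) (e *: row_mx h 0) - g (row_mx v w))).
by apply/funext => e /=; rewrite scale_row_mx add_row_mx scaler0 add0r.
Qed.

Lemma derive_row_mxr (W : normedModType R) (g : 'rV[R]_(m + m) -> W)
    (v w h : 'rV[R]_m) :
  'D_h (fun w => g (row_mx v w)) w = 'D_(row_mx 0 h) g (row_mx v w).
Proof.
rewrite /derive.
have -> // : (fun e : R => e^-1 *: (((fun w => g (row_mx v w)) \o shift w) (e *: h) - g (row_mx v w))) =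
    (fun e => e^-1 *: ((g \o shift (row_mx v w)) (e *: row_mx 0 h) - g (row_mx v w))).
by apply/funext => e /=; rewrite scale_row_mx add_row_mx scaler0 add0r.
Qed.

Lemma continuous_row_mx (p q : nat) (u : topologicalType)
    (f : u -> 'rV[R]_p) (g : u -> 'rV[R]_q) (x : u) :
  {for x, continuous f} -> {for x, continuous g} ->
  {for x, continuous (fun y => row_mx (f y) (g y))}.
Proof.
move=> cf cg.
have -> : (fun y => row_mx (f y) (g y)) =
    (fun y => mulmxr (row_mx 1%:M 0) (f y) + mulmxr (row_mx 0 1%:M) (g y)).
  apply/funext => y /=.
  by rewrite !mul_mx_row !mulmx1 !mulmx0 add_row_mx addr0 add0r.
apply: cvgD.
  exact: (cvg_comp _ _ cf (@rV_linear_continuous R p _ (mulmxr (row_mx 1%:M 0)) _)).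
exact: (cvg_comp _ _ cg (@rV_linear_continuous R q _ (mulmxr (row_mx 0 1%:M)) _)).
Qed.

Variable M : manifold R m.

Lemma chart2_im_open (c d : chart R m M) : open (chart2_im c d).
Proof.
have -> : chart2_im c d =
   (lsubmx @^-1` chart_im c) `&` (rsubmx @^-1` chart_im d) by [].
apply: openI; apply: open_comp; try exact: chart_im_open.
  by move=> v _; exact: continuous_lsubmx.
by move=> v _; exact: continuous_rsubmx.
Qed.

Lemma chart2_invK (c d : chart R m M) (v : 'rV[R]_(m + m)) :
  chart2_im c d v -> chart2_map c d (chart2_inv c d v) = v.
Proof.
by case=> vl vr; rewrite /chart2_map /= !chart_invK // hsubmxK.
Qed.

Lemma chart2_inv_row_mx (c d : chart R m M) (v w : 'rV[R]_m) :
  chart2_inv c d (row_mx v w) = (chart_inv c v, chart_inv d w).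
Proof. by rewrite /chart2_inv row_mxKl row_mxKr. Qed.

Lemma chart2_mapP (c d : chart R m M) (x y : M) :
  chart_dom c x -> chart_dom d y -> chart2_im c d (chart2_map c d (x, y)).
Proof.
by move=> xc yd; split; rewrite ?row_mxKl ?row_mxKr; exact: chart_mapP.
Qed.

Lemma chart2_mapK (c d : chart R m M) (x y : M) :
  chart_dom c x -> chart_dom d y ->
  chart2_inv c d (chart2_map c d (x, y)) = (x, y).
Proof. by move=> xc yd; rewrite chart2_inv_row_mx !chart_mapK. Qed.

Lemma chart2_map_cont (c d : chart R m M) (x y : M) :
  chart_dom c x -> chart_dom d y ->
  {for (x, y), continuous (chart2_map c d)}.
Proof.
move=> xc yd; apply: continuous_row_mx.
  apply: (@continuous_comp _ _ _ (fst : M * M -> M) c (x, y)).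
    exact: cvg_fst.
  exact: chart_map_cont.
apply: (@continuous_comp _ _ _ (snd : M * M -> M) d (x, y)).
  exact: cvg_snd.
exact: chart_map_cont.
Qed.

Lemma chart2_inv_cont (c d : chart R m M) (v : 'rV[R]_(m + m)) :
  chart2_im c d v -> {for v, continuous (chart2_inv c d)}.
Proof.
case=> vl vr.
have cl : {for v, continuous (fun w => chart_inv c (lsubmx w))}.
  apply: (@continuous_comp _ _ _ (lsubmx : 'rV[R]_(m + m) -> _) (chart_inv c)).
    exact: continuous_lsubmx.
  exact: chart_inv_cont.
have cr : {for v, continuous (fun w => chart_inv d (rsubmx w))}.
  apply: (@continuous_comp _ _ _ (rsubmx : 'rV[R]_(m + m) -> _) (chart_inv d)).
    exact: continuous_rsubmx.
  exact: chart_inv_cont.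
exact: cvg_pair cl cr.
Qed.

End Charts.

(** * The Lagrangian in charts *)

Section LocalLagrangian.
Variables (R : realType) (m : nat).

Lemma smooth_differentiable (k : nat) (O : set 'rV[R]_k) (f : 'rV[R]_k -> R) v :
  smooth_on O f -> O v -> differentiable f v.
Proof. by move=> /(_ 1%N)[df _] Ov; exact (df v Ov). Qed.

Lemma smooth_differentiable_derive (k : nat) (O : set 'rV[R]_k)
    (f : 'rV[R]_k -> R) h v :
  smooth_on O f -> O v -> differentiable ('D_h f) v.
Proof. by move=> /(_ 2%N)[_ df] Ov; exact ((df h).1 v Ov). Qed.

Lemma smooth_derive_comm (p : nat) (O : set 'rV[R]_p) (f : 'rV[R]_p -> R) h k v :
  open O -> smooth_on O f -> O v ->
  'D_k ('D_h f) v = 'D_h ('D_k f) v.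
Proof.
move=> oO sf Ov; apply: derive_comm.
- have := open_nbhs_nbhs (conj oO Ov); apply: filterS => y Oy.
  have df := smooth_differentiable sf Oy.
  have ddf u := smooth_differentiable_derive u sf Oy.
  exact (And4 (diff_derivable df) (diff_derivable df)
    (diff_derivable (ddf h)) (diff_derivable (ddf k))).
- exact (((sf 2%N).2 h).2 k v Ov).
- exact (((sf 2%N).2 k).2 h v Ov).
Qed.

(** The two halves of the gradient of a function of a pair (v, w), encoded as
    the row vector row_mx v w. *)
Definition grad1 (f : 'rV[R]_(m + m) -> R) (v : 'rV[R]_(m + m)) : 'rV[R]_m :=
  \row_b 'D_(row_mx (basis_vec R b) 0) f v.
Definition grad2 (f : 'rV[R]_(m + m) -> R) (v : 'rV[R]_(m + m)) : 'rV[R]_m :=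
  \row_b 'D_(row_mx 0 (basis_vec R b)) f v.

Lemma basis_vec_lshift (a : 'I_m) :
  basis_vec R (lshift m a) = row_mx (basis_vec R a) 0.
Proof.
apply/rowP => j; rewrite !mxE eqxx /=; case: splitP => i ij.
  by rewrite mxE eqxx /= -(inj_eq val_inj) /= ij.
by rewrite mxE -(inj_eq val_inj) /= ij gtn_eqF // (leq_trans (ltn_ord a)) ?leq_addr.
Qed.

Lemma basis_vec_rshift (a : 'I_m) :
  basis_vec R (rshift m a) = row_mx 0 (basis_vec R a).
Proof.
apply/rowP => j; rewrite !mxE eqxx /=; case: splitP => i ij.
  by rewrite mxE -(inj_eq val_inj) /= ij ltn_eqF // (leq_trans (ltn_ord i)) ?leq_addr.
by rewrite mxE eqxx /= -(inj_eq val_inj) /= ij eqn_add2l.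
Qed.

Variables (M : manifold R m) (L : M * M -> R).
Hypothesis L_smooth : smooth_lagrangian L.

Section Pair.
Variables (c d : chart R m M) (x y : M).
Hypotheses (xc : chart_at x c) (yd : chart_at y d).
Let f := L \o chart2_inv c d.
Let q := chart2_map c d (x, y).

(** Freezing one argument of L amounts to freezing one half of the coordinates
    of its local expression f. *)
Lemma lagrangian_chartl : (fun v => L (chart_inv c v, y)) = (fun v => f (row_mx v (d y))).
Proof.
by apply/funext => v; rewrite /f /= chart2_inv_row_mx (chart_mapK yd.2).
Qed.

Lemma lagrangian_chartr : (fun w => L (x, chart_inv d w)) = (fun w => f (row_mx (c x) w)).
Proof.
by apply/funext => v; rewrite /f /= chart2_inv_row_mx (chart_mapK xc.2).
Qed.

Lemma dL1_grad1 : dL1 L c x y = grad1 f q.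
Proof.
by apply/rowP => b; rewrite !mxE lagrangian_chartl (derive_row_mxl f).
Qed.

Lemma dL2_grad2 : dL2 L d x y = grad2 f q.
Proof.
by apply/rowP => b; rewrite !mxE lagrangian_chartr (derive_row_mxr f).
Qed.

Lemma dL11E a b : dL11 L c x y a b =
  'D_(row_mx (basis_vec R a) 0) ('D_(row_mx (basis_vec R b) 0) f) q.
Proof.
rewrite mxE lagrangian_chartl.
have -> : 'D_(basis_vec R b) (fun v => f (row_mx v (d y))) =
    (fun v => 'D_(row_mx (basis_vec R b) 0) f (row_mx v (d y))).
  by apply/funext => v; rewrite (derive_row_mxl f).
by rewrite (derive_row_mxl ('D_(row_mx (basis_vec R b) 0) f)).
Qed.

Lemma dL22E a b : dL22 L d x y a b =
  'D_(row_mx 0 (basis_vec R a)) ('D_(row_mx 0 (basis_vec R b)) f) q.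
Proof.
rewrite mxE lagrangian_chartr.
have -> : 'D_(basis_vec R b) (fun v => f (row_mx (c x) v)) =
    (fun v => 'D_(row_mx 0 (basis_vec R b)) f (row_mx (c x) v)).
  by apply/funext => v; rewrite (derive_row_mxr f).
by rewrite (derive_row_mxr ('D_(row_mx 0 (basis_vec R b)) f)).
Qed.

Lemma dL12E a b : dL12 L c d x y a b =
  'D_(row_mx (basis_vec R a) 0) ('D_(row_mx 0 (basis_vec R b)) f) q.
Proof.
rewrite mxE.
have -> : (fun v => 'D_(basis_vec R b) (fun w => L (chart_inv c v, chart_inv d w)) (d y))
  = (fun v => 'D_(row_mx 0 (basis_vec R b)) f (row_mx v (d y))).
  apply/funext => v; rewrite -(derive_row_mxr f); congr ('D_ _ _ _).
  by apply/funext => w; rewrite /f /= chart2_inv_row_mx.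
by rewrite (derive_row_mxl ('D_(row_mx 0 (basis_vec R b)) f)).
Qed.

Let f_smooth : smooth_on (chart2_im c d) f := L_smooth xc.1 yd.1.
Let qO : chart2_im c d q := chart2_mapP xc.2 yd.2.

Lemma has_jacobian_grad2 :
  has_jacobian (grad2 f) q (col_mx (dL12 L c d x y) (dL22 L d x y)).
Proof.
have := @has_jacobian_row R _ _ (fun b => 'D_(row_mx 0 (basis_vec R b)) f) q.
move=> /(_ (fun b => smooth_differentiable_derive _ f_smooth qO)).
congr has_jacobian; apply/matrixP => a b; rewrite -(fintype.splitK a).
case: (fintype.split a) => i /=.
  by rewrite col_mxEu dL12E mxE basis_vec_lshift.
by rewrite col_mxEd dL22E mxE basis_vec_rshift.
Qed.

(** The off-diagonal block dL12^T differentiates in y first, then in x, whereas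
    dL12 does the opposite: this is where symmetry of the second derivatives
    enters. *)
Lemma has_jacobian_grad1 :
  has_jacobian (grad1 f) q (col_mx (dL11 L c x y) (dL12 L c d x y)^T).
Proof.
have := @has_jacobian_row R _ _ (fun b => 'D_(row_mx (basis_vec R b) 0) f) q.
move=> /(_ (fun b => smooth_differentiable_derive _ f_smooth qO)).
congr has_jacobian; apply/matrixP => a b; rewrite -(fintype.splitK a).
case: (fintype.split a) => i /=.
  by rewrite col_mxEu dL11E mxE basis_vec_lshift.
rewrite col_mxEd [RHS]mxE dL12E [LHS]mxE basis_vec_rshift.
exact (smooth_derive_comm _ _ (@chart2_im_open _ _ _ c d) f_smooth qO).
Qed.

End Pair.
End LocalLagrangian.

(** * The discrete Lagrangian map in charts *)

Section BlockIdentities.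
Variables (F : comUnitRingType) (m : nat).
Implicit Types a b : 'M[F]_m.

Lemma block_mx_eliminatel a b :
  block_mx 1%:M a 0 b =
  block_mx 1%:M 0 0 0 + col_mx a b *m row_mx 0 1%:M :> 'M[F]_(m + m).
Proof. by rewrite mul_col_row !mulmx1 !mulmx0 add_block_mx !addr0 !add0r. Qed.

Lemma block_mx_eliminater a b :
  block_mx 0 (- a) 1%:M (- b) =
  block_mx 0 0 1%:M 0 + col_mx a b *m row_mx 0 (- 1%:M) :> 'M[F]_(m + m).
Proof.
by rewrite mul_col_row !mulmxN !mulmx1 !mulmx0 add_block_mx !addr0 !add0r.
Qed.

(** The linear map (u, v) |-> (v, w), where w solves
    u a12 + v (a22 + a11) + w b = 0. *)
Lemma block_mx_solve (a12 a22 a11 b : 'M[F]_m) : b \in unitmx ->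
  block_mx 0 (- a12) 1%:M (- a22) *m invmx (block_mx 1%:M a11 0 b) =
  block_mx 0 (- (- a12 *m invmx (- b))) 1%:M ((a22 + a11) *m invmx (- b)).
Proof.
move=> bu; have nbu : - b \in unitmx by rewrite -scaleN1r unitmxZ ?unitrN1.
have Qu : block_mx 1%:M a11 0 b \in unitmx.
  by rewrite unitmxE det_ublock det1 mul1r -unitmxE.
rewrite -[RHS](mulmxK Qu); congr (_ *m _).
have E a : a *m invmx (- b) *m b = - a.
  by rewrite -[X in _ *m X]opprK mulmxN mulmxKV.
rewrite mulmx_block !mul0mx !mulmx0 !mulmx1 !mul1mx !add0r !addr0 mulNmx !E.
by rewrite opprK opprD addrCA subrr addr0.
Qed.

End BlockIdentities.

Section Trajectory.
Variables (R : realType) (m : nat) (M : manifold R m) (L : M * M -> R).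
Hypothesis L_smooth : smooth_lagrangian L.

Section Step.
Variables (c d e : chart R m M) (x y z : M) (T : M * M -> M * M).
Hypotheses (xc : chart_at x c) (yd : chart_at y d) (ze : chart_at z e).
Hypothesis T_map : lagrangian_map_near L x y z T.
Hypothesis yz_twist : twistB L d e y z \in unitmx.

Let q := chart2_map c d (x, y).
Let f := L \o chart2_inv c d.
Let g := L \o chart2_inv d e.
(* the branch T read in charts *)
Let t := chart2_map d e \o T \o chart2_inv c d.

Lemma near_chart_inv (P : M * M -> Prop) :
  (\forall p \near (x, y), P p) -> \forall v \near q, P (chart2_inv c d v).
Proof.
move=> nP; have := @chart2_inv_cont _ _ _ c d q (chart2_mapP xc.2 yd.2).
by apply; rewrite (chart2_mapK xc.2 yd.2).
Qed.

Lemma near_chart_dom (c' d' : chart R m M) (x' y' : M) :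
  chart_dom c' x' -> chart_dom d' y' ->
  \forall p \near (x', y'), chart_dom c' p.1 /\ chart_dom d' p.2.
Proof.
move=> xc' yd'.
exists (chart_dom c', chart_dom d'); last by case=> u v [].
by split; apply: open_nbhs_nbhs; split => //; exact: chart_dom_open.
Qed.

Lemma local_map_at : t q = chart2_map d e (y, z).
Proof. by rewrite /t /= (chart2_mapK xc.2 yd.2); case: T_map => ->. Qed.

Lemma local_map_continuous : {for q, continuous t}.
Proof.
have [Txy cT _] := T_map.
apply: (@continuous_comp _ _ _ (chart2_inv c d) (chart2_map d e \o T) q).
  by apply: chart2_inv_cont; exact: (chart2_mapP xc.2 yd.2).
rewrite (chart2_mapK xc.2 yd.2).
apply: (@continuous_comp _ _ _ T (chart2_map d e) (x, y)) => //.
by rewrite Txy; exact: (chart2_map_cont yd.2 ze.2).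
Qed.

(** The discrete Euler-Lagrange equation, together with (T p).1 = p.2, in the
    form Phi (t v) = Psi v to which has_jacobian_implicit applies. *)
Lemma local_map_equation : \forall v \near q,
  row_mx (lsubmx (t v)) (grad1 g (t v)) = row_mx (rsubmx v) (- grad2 f v).
Proof.
have [Txy cT nT] := T_map.
have n1 := near_chart_inv nT.
have n2 := near_chart_inv (near_chart_dom xc.2 yd.2).
have n3 := near_chart_dom yd.2 ze.2.
rewrite -Txy in n3.
have n4 := near_chart_inv (cT _ n3).
have n5 : \forall v \near q, chart2_im c d v.
  apply: open_nbhs_nbhs; split; first exact: chart2_im_open.
  exact: (chart2_mapP xc.2 yd.2).
move: n1; apply: filter_app; move: n2; apply: filter_app.
move: n4; apply: filter_app; move: n5; apply: filter_app.
near=> v => vO /= [_ ze'] [xc' yd'] [T1 EL].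
have vE : v = row_mx (c (chart_inv c (lsubmx v))) (d (chart_inv d (rsubmx v))).
  by rewrite -[LHS](chart2_invK vO).
set p := chart2_inv c d v in T1 EL ze' xc' yd' *.
have tE : t v = row_mx (d p.2) (e (T p).2) by rewrite /t /= /chart2_map -T1.
have := EL d (conj yd.1 yd').
rewrite (dL2_grad2 L d _ (conj xc.1 xc')) (dL1_grad1 L d _ (conj ze.1 ze')).
rewrite -[chart2_map d e _]tE -[chart2_map c d _]vE => EL0.
congr row_mx.
  by rewrite tE row_mxKl; case: vO => _ vr; rewrite chart_invK.
by apply/eqP; rewrite -addr_eq0 addrC EL0.
Unshelve. all: by end_near. Qed.

Lemma has_jacobian_local_map :
  has_jacobian t q
    (block_mx 0 (- (twistB L c d x y *m invmx (twistB L d e y z)^T))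
       1%:M ((dL22 L d x y + dL11 L d y z) *m invmx (twistB L d e y z)^T)).
Proof.
pose Phi w : 'rV[R]_(m + m) := row_mx (lsubmx w) (grad1 g w).
pose Psi v : 'rV[R]_(m + m) := row_mx (rsubmx v) (- grad2 f v).
pose J2 := (dL12 L d e y z)^T.
pose Q : 'M[R]_(m + m) := block_mx 1%:M (dL11 L d y z) 0 J2.
pose K : 'M[R]_(m + m) := block_mx 0 (- dL12 L c d x y) 1%:M (- dL22 L d x y).
have J2E : (twistB L d e y z)^T = - J2 by rewrite /twistB linearN.
have J2u : J2 \in unitmx.
  by rewrite unitmx_tr; move: yz_twist; rewrite /twistB -scaleN1r unitmxZ ?unitrN1.
have Qu : Q \in unitmx by rewrite unitmxE det_ublock det1 mul1r -unitmxE.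
have dPhi : has_jacobian Phi (t q) Q.
  have -> : Phi = (fun w => mulmxr (block_mx 1%:M 0 0 0) w
                  + mulmxr (row_mx 0 1%:M) (grad1 g w)).
    apply/funext => w; rewrite /= -[in mulmx w](hsubmxK w) mul_row_block mul_mx_row.
    by rewrite !mulmx1 !mulmx0 !addr0 add_row_mx addr0 add0r.
  rewrite /Q (block_mx_eliminatel (dL11 L d y z) J2).
  apply: (has_jacobian_add (has_jacobian_mulmx _ _)).
  apply: (has_jacobian_comp (g := mulmxr (row_mx 0 1%:M)) _ (has_jacobian_mulmx _ _)).
  by rewrite local_map_at; exact (has_jacobian_grad1 L_smooth yd ze).
have dPsi : has_jacobian Psi q K.
  have -> : Psi = (fun w => mulmxr (block_mx 0 0 1%:M 0) w
                  + mulmxr (row_mx 0 (- 1%:M)) (grad2 f w)).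
    apply/funext => w; rewrite /= -[in mulmx w](hsubmxK w) mul_row_block mul_mx_row.
    by rewrite mulmxN !mulmx1 !mulmx0 !addr0 add_row_mx ?addr0 !add0r.
  rewrite /K (block_mx_eliminater (dL12 L c d x y) (dL22 L d x y)).
  apply: (has_jacobian_add (has_jacobian_mulmx _ _)).
  apply: (has_jacobian_comp (g := mulmxr (row_mx 0 (- 1%:M))) _ (has_jacobian_mulmx _ _)).
  exact (has_jacobian_grad2 L_smooth xc yd).
have := has_jacobian_implicit local_map_continuous dPhi Qu dPsi local_map_equation.
by rewrite J2E /K /Q block_mx_solve.
Qed.

End Step.
End Trajectory.

(** * The linear Poincare map as a product of transfer matrices *)

Section Chain.
Variables (R : realType) (m : nat) (M : manifold R m) (L : M * M -> R).
Variables (x : int -> M) (T : int -> M * M -> M * M) (c : int -> chart R m M).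
Hypotheses (L_smooth : smooth_lagrangian L)
  (x_twist : forall i, twist L (x i) (x (i + 1)))
  (T_map : lagrangian_map_along L x T)
  (c_chart : forall i, chart_at (x i) (c i)).

Let A := opA L c x.
Let B := opB L c x.

Lemma opB_unit i : B i \in unitmx.
Proof. exact: (x_twist (c_chart i) (c_chart (i + 1))). Qed.

Lemma has_jacobian_transfer (i : int) :
  has_jacobian
    (chart2_map (c (i + 1)) (c (i + 2)) \o T i \o chart2_inv (c i) (c (i + 1)))
    (chart2_map (c i) (c (i + 1)) (x i, x (i + 1))) (transfer A B i).
Proof.
have i2 : i + 1 + 1 = i + 2 by rewrite -addrA.
have := x_twist (c_chart (i + 1)) (c_chart (i + 1 + 1)); rewrite i2 => tw.
have := has_jacobian_local_map L_smooth (c_chart i) (c_chart (i + 1))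
  (c_chart (i + 2)) (T_map i) tw.
by rewrite /transfer /A /B /opA /opB i2 addrK.
Qed.

(** Only germs at the trajectory matter: the continuity of the iterate keeps
    nearby points in the chart domains, where the chart changes cancel. *)
Lemma has_jacobian_iter (k : nat) :
  [/\ map_iter T k (x 1, x 2) = (x k.+1%:Z, x k.+2%:Z),
      {for (x 1, x 2), continuous (map_iter T k)} &
      has_jacobian
        (chart2_map (c k.+1%:Z) (c k.+2%:Z) \o map_iter T k
           \o chart2_inv (c 1) (c 2))
        (chart2_map (c 1) (c 2) (x 1, x 2)) (transfer_prod A B k)].
Proof.
set q := chart2_map (c 1) (c 2) (x 1, x 2).
have qO : chart2_im (c 1) (c 2) q.
  exact: (chart2_mapP (c_chart 1).2 (c_chart 2).2).
have qK : chart2_inv (c 1) (c 2) q = (x 1, x 2).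
  exact: (chart2_mapK (c_chart 1).2 (c_chart 2).2).
elim: k => [|k [IHx IHc IHj]].
  split=> //.
  apply: has_jacobian_near (has_jacobian_mulmx 1%:M q).
  have := open_nbhs_nbhs (conj (@chart2_im_open _ _ _ (c 1) (c 2)) qO).
  apply: filterS => v vO.
  by rewrite /= mulmx1 -[RHS]/(chart2_map (c 1) (c 2) (chart2_inv (c 1) (c 2) v)) chart2_invK.
set i : int := k.+1%:Z.
have i1 : k.+2%:Z = i + 1 by rewrite /i -PoszD addn1.
have i2 : k.+3%:Z = i + 2 by rewrite /i -PoszD addn2.
have [Tx Tc _] := T_map i.
rewrite i1 i2; rewrite -/i i1 in IHx IHj.
split.
- by rewrite /= IHx Tx.
- apply: (@continuous_comp _ _ _ (map_iter T k) (T i) (x 1, x 2)) => //.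
  by rewrite IHx.
- have near_dom := near_chart_dom (c_chart i).2 (c_chart (i + 1)).2.
  have n1 : \forall p \near (x 1, x 2), chart_dom (c i) (map_iter T k p).1 /\
      chart_dom (c (i + 1)) (map_iter T k p).2.
    by apply: (IHc (fun p => _ p.1 /\ _ p.2)); rewrite IHx.
  have n2 := near_chart_inv (c_chart 1) (c_chart 2) n1.
  have Jc := has_jacobian_comp IHj.
  have E : (chart2_map (c i) (c (i + 1)) \o map_iter T k
      \o chart2_inv (c 1) (c 2)) q = chart2_map (c i) (c (i + 1)) (x i, x (i + 1)).
    by rewrite -IHx -qK.
  have := has_jacobian_transfer i.
  rewrite -E => /Jc; apply: has_jacobian_near.
  apply: filterS n2 => v /= [d1 d2].
  by case: (map_iter T k (chart2_inv (c 1) (c 2) v)) d1 d2 => u w /= d1 d2;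
     rewrite chart2_mapK.
Qed.

End Chain.

Lemma map_transfer_prod (F F' : fieldType) (h : {rmorphism F -> F'}) (m : nat)
    (A B : int -> 'M[F]_m) (k : nat) :
  map_mx h (transfer_prod A B k) =
  transfer_prod (fun i => map_mx h (A i)) (fun i => map_mx h (B i)) k.
Proof.
elim: k => [|k IHk] /=; first by rewrite map_mx1.
rewrite map_mxM IHk /transfer map_block_mx map_mx0 map_mx1 map_mxN !map_mxM.
by rewrite !map_invmx !map_trmx.
Qed.

(** * The determinant identity *)

Theorem theorem2p2 (R : realType) (m : nat) (M : manifold R m) (L : M * M -> R)
    (n : nat) (x : int -> M) (T : int -> M * M -> M * M)
    (c : int -> chart R m M) (rho : R[i]%C)
    (L_smooth : smooth_lagrangian L)
    (n_gt0 : (0 < n)%N)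
    (x_traj : periodic_trajectory L n x)
    (x_twist : forall i, twist L (x i) (x (i + 1)))
    (T_map : lagrangian_map_along L x T)
    (c_chart : forall i, chart_at (x i) (c i))
    (c_periodic : forall i, c (i + n%:Z) = c i)
    (rho_neq0 : rho != 0) :
  let P := complexify (poincare c n x T) in
  let A := fun i => complexify (opA L c x i) in
  let B := fun i => complexify (opB L c x i) in
  \det (P - rho%:M) = detH n A B rho / detB n B rho.
Proof.
move=> P A B; case: n n_gt0 x_traj c_periodic @P => // n' _ [x_per _] c_per P.
have [_ _] := has_jacobian_iter L_smooth x_twist T_map c_chart n'.+1.
have -> : n'.+2%:Z = 1 + n'.+1%:Z by rewrite -PoszD.
have -> : n'.+3%:Z = 2 + n'.+1%:Z by rewrite -PoszD.
rewrite !c_per => -[_ PE].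
have -> : P = transfer_prod A B n'.+1.
  by rewrite /P /complexify /poincare PE map_transfer_prod.
have B_unit i : B i \in unitmx.
  rewrite /B /complexify map_unitmx; exact: (opB_unit x_twist c_chart).
have per1 (i : int) : i + n'.+1%:Z + 1 = i + 1 + n'.+1%:Z by rewrite addrAC.
have opA_per (i : int) : opA L c x (i + n'.+1%:Z) = opA L c x i.
  rewrite /opA per1 (addrAC i _ (- 1)).
  by rewrite (x_per (i - 1)) (x_per i) (x_per (i + 1)) (c_per i).
have opB_per (i : int) : opB L c x (i + n'.+1%:Z) = opB L c x i.
  rewrite /opB per1.
  by rewrite (x_per (i + 1)) (x_per i) (c_per (i + 1)) (c_per i).
have A_per (i : int) : A (i + n'.+1%:Z) = A i by rewrite /A opA_per.
have B_per (i : int) : B (i + n'.+1%:Z) = B i by rewrite /B opB_per.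
exact (det_transfer_prod_sub rho_neq0 B_unit A_per B_per).
Qed.
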